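(* Let $\tau\in\mathfrak{S}_m$ be fixed and let $\sigma_i\in\mathfrak{S}_{n_i}$, $i\ge1$, be a sequence of permutations with $n_i\to\infty$ and $\Lambda^\tau(\sigma_i)=o(n_i^m)$. Then there are sets of index pairs $\mathcal{S}_i\subset\binom{\mathbb{Z}_{n_i}}{2}$ with $|\mathcal{S}_i|=o(n_i^2)$ such that, for every $i$, the deletion of $\mathcal{S}_i$ destroys all copies of $\tau$ in $\sigma_i$.
   Context: $\mathfrak{S}_n$ is the set of permutations of $\mathbb{Z}_n$, where $\mathbb{Z}_n$ is identified with $\{0,1,\ldots,n-1\}$ with its usual linear order, and $\binom{\mathbb{Z}_n}{2}$ is the set of $2$-element subsets of $\mathbb{Z}_n$. For $\tau\in\mathfrak{S}_m$ and $\sigma\in\mathfrak{S}_n$, a copy of $\tau$ in $\sigma$ is given by its index set, i.e. a set $\{x_0<\cdots<x_{m-1}\}\subset\mathbb{Z}_n$ such that for all $i,j$: $\sigma(x_i)<\sigma(x_j)$ iff $\tau(i)<\tau(j)$; $\Lambda^\tau(\sigma)$ is the number of copies of $\tau$ in $\sigma$. The deletion of a set $\mathcal{S}\subset\binom{\mathbb{Z}_n}{2}$ of index pairs destroys all copies of $\tau$ in $\sigma$ if the index set of every copy of $\tau$ in $\sigma$ contains both points of some element of $\mathcal{S}$. *)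

(* Defs.v *)
From HB Require Import structures.
From mathcomp Require Import all_boot all_order all_fingroup all_algebra.
From mathcomp Require Import all_classical all_reals all_analysis.

Set Implicit Arguments.
Unset Strict Implicit.
Unset Printing Implicit Defensive.

(* The index set Z_n is 'I_n and S_n is {perm 'I_n}; the order on indices and
   on values is the one of the underlying natural numbers. *)

(* X = {x_0 < ... < x_(m-1)}; the increasing enumeration of X is unique, so
   the existential merely names it. *)
Definition is_copy (m n : nat) (tau : 'S_m) (sigma : 'S_n) (X : {set 'I_n}) :
    bool :=
  [exists x : {ffun 'I_m -> 'I_n},
    [&& X == [set x i | i : 'I_m],
        [forall i : 'I_m, forall j : 'I_m, (i < j)%N ==> (x i < x j)%N] &
        [forall i : 'I_m, forall j : 'I_m,
           (sigma (x i) < sigma (x j))%N == (tau i < tau j)%N]]].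

Definition num_copies (m n : nat) (tau : 'S_m) (sigma : 'S_n) : nat :=
  #|[set X : {set 'I_n} | is_copy tau sigma X]|.

Definition index_pairs (n : nat) : {set {set 'I_n}} :=
  [set P : {set 'I_n} | #|P| == 2%N].

Definition destroys_copies (m n : nat) (S : {set {set 'I_n}})
    (tau : 'S_m) (sigma : 'S_n) : Prop :=
  forall X : {set 'I_n}, is_copy tau sigma X ->
    exists2 P : {set 'I_n}, P \in S & P \subset X.

(* Main.v *)
(** Cut indices and values into boundedly many intervals of length at most L.
    Delete every pair whose indices or whose values share an interval, and every
    pair containing a point of a cell (interval of indices times interval of
    values) with fewer than t points.  A surviving copy of tau has its points in
    distinct columns, in distinct rows and in cells with at least t points, and
    then any choice of one point in each of its cells is again a copy of tau:
    there are at least t ^ m copies.  With L and t small multiples of n this is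
    incompatible with o(n ^ m) copies, while only a small multiple of n ^ 2
    pairs are deleted. *)
Require Import Defs.
From HB Require Import structures.
From mathcomp Require Import all_boot all_order all_fingroup all_algebra.
From mathcomp Require Import all_classical all_reals all_analysis.
From mathcomp Require Import zify ring lra.
Import Order.TTheory GRing.Theory Num.Theory.
Import numFieldNormedType.Exports.

Set Implicit Arguments.
Unset Strict Implicit.
Unset Printing Implicit Defensive.

(** * Copies as pattern-preserving increasing maps *)

Section Embeddings.
Variables (m n : nat) (tau : 'S_m) (sigma : 'S_n).

Definition is_embedding (x : {ffun 'I_m -> 'I_n}) : bool :=
  [forall i : 'I_m, forall j : 'I_m, (i < j)%N ==> (x i < x j)%N] &&
  [forall i : 'I_m, forall j : 'I_m,
     (sigma (x i) < sigma (x j))%N == (tau i < tau j)%N].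

Lemma is_embeddingP (x : {ffun 'I_m -> 'I_n}) :
  reflect ((forall i j : 'I_m, (i < j)%N -> (x i < x j)%N) /\
           (forall i j : 'I_m,
              (sigma (x i) < sigma (x j))%N = (tau i < tau j)%N))
          (is_embedding x).
Proof.
apply: (iffP andP) => -[incr_x pat_x]; split.
- by move=> i j; move/forallP/(_ i)/forallP/(_ j)/implyP: incr_x.
- by move=> i j; move/forallP/(_ i)/forallP/(_ j)/eqP: pat_x.
- by apply/forallP=> i; apply/forallP=> j; apply/implyP/incr_x.
- by apply/forallP=> i; apply/forallP=> j; apply/eqP/pat_x.
Qed.

Lemma is_copyP (X : {set 'I_n}) :
  reflect (exists2 x : {ffun 'I_m -> 'I_n},
             is_embedding x & X = [set x i | i : 'I_m])
          (is_copy tau sigma X).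
Proof.
apply: (iffP existsP) => [[x /andP[/eqP defX emb_x]]|[x emb_x ->]].
  by exists x.
by exists x; rewrite eqxx.
Qed.

(** Both maps list their image in increasing order, and a strictly sorted list is determined by its
    members. *)
Lemma embedding_image_inj :
  {in is_embedding &, injective
    (fun x : {ffun 'I_m -> 'I_n} => [set x i | i : 'I_m])}.
Proof.
have sorted_emb (x : {ffun 'I_m -> 'I_n}) : is_embedding x ->
    sorted ltn [seq val (x i) | i <- enum 'I_m].
  move=> /is_embeddingP[incr_x _].
  apply: (@homo_sorted _ _ (fun i : 'I_m => val (x i)) (relpre val ltn)).
    by move=> i j; exact: incr_x.
  by rewrite -sorted_map val_enum_ord iota_ltn_sorted.
move=> x y x_emb y_emb /setP eq_im; apply/ffunP=> i; apply: val_inj.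
suff /eq_in_map : [seq val (x i) | i <- enum 'I_m] =
                  [seq val (y i) | i <- enum 'I_m].
  by apply; rewrite mem_enum.
have sub_im (u v : {ffun 'I_m -> 'I_n}) :
    [set u i | i : 'I_m] =i [set v i | i : 'I_m] ->
    {subset [seq val (u i) | i <- enum 'I_m] <=
            [seq val (v i) | i <- enum 'I_m]}.
  move=> eq_uv _ /mapP[j _ ->].
  have: u j \in [set v i | i : 'I_m] by rewrite -eq_uv imset_f.
  by case/imsetP=> k _ ->; apply: map_f; rewrite mem_enum.
apply: (irr_sorted_eq ltn_trans ltnn); [exact: sorted_emb..|].
by move=> k; apply/idP/idP; apply: sub_im => // z; rewrite eq_im.
Qed.

Lemma leq_embeddings_num_copies :
  (#|[set x | is_embedding x]| <= num_copies tau sigma)%N.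
Proof.
rewrite -(card_in_imset (f := fun x : {ffun 'I_m -> 'I_n} => [set x i | i : 'I_m])).
  apply: subset_leq_card; apply/fintype.subsetP=> _ /imsetP[x + ->].
  by rewrite !inE => x_emb; apply/is_copyP; exists x.
by move=> x y; rewrite !inE => x_emb y_emb; exact: embedding_image_inj.
Qed.

End Embeddings.

(** * Counting in blocks and cells *)

Lemma card_imset_fiber_lt (A B : finType) (f : A -> B) (t : nat) :
  (#|[set x | #|f @^-1: [set f x]| < t]| <= #|B| * t)%N.
Proof.
rewrite -sum1_card (partition_big f predT) //= -sum_nat_const.
apply: leq_sum => b _; rewrite sum1_card.
have [/existsP[x /andP[]]|/existsPn no_x] := boolP [exists x,
    (x \in [set x | #|f @^-1: [set f x]| < t]%N) && (f x == b)].
  rewrite inE => /ltnW + /eqP fx; rewrite fx; apply: leq_trans.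
  apply: subset_leq_card; apply/fintype.subsetP=> y.
  by rewrite unfold_in !inE => /andP[].
by rewrite eq_card0 // => x; rewrite unfold_in; apply/negbTE/no_x.
Qed.

Lemma card_divn_fiber (n L k : nat) :
  (0 < L)%N -> (#|[set y : 'I_n | y %/ L == k]| <= L)%N.
Proof.
move=> L_gt0; rewrite -[leqRHS]card_ord.
pose r (y : 'I_n) : 'I_L := Ordinal (ltn_pmod y L_gt0).
rewrite -(card_in_imset (f := r)) ?max_card // => y z.
rewrite !inE => /eqP yk /eqP zk /(congr1 val) /= eq_mod; apply: val_inj.
by rewrite /= (divn_eq y L) (divn_eq z L) yk zk eq_mod.
Qed.

Lemma card_pairs_leq (A B : finType) (P : A -> B -> bool) (b : nat) :
  (forall x, #|[set y | P x y]| <= b)%N ->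
  (#|[set p : A * B | P p.1 p.2]| <= #|A| * b)%N.
Proof.
move=> le_b; rewrite cardsE -sum1_card -(pair_big_dep xpredT P (fun _ _ => 1%N)) /=.
rewrite -sum_nat_const; apply: leq_sum => x _; apply: leq_trans (le_b x).
by rewrite sum1_card cardsE.
Qed.

(** Across distinct blocks the order depends on the blocks alone, so points may be moved freely
    within their blocks. *)
Lemma ltn_divn_neq (L a b : nat) :
  a %/ L != b %/ L -> (a < b)%N = (a %/ L < b %/ L)%N.
Proof.
move=> neq; apply/idP/idP => [/ltnW le_ab|].
  by rewrite ltn_neqAle neq leq_div2r.
by apply: contraTT; rewrite -2!leqNgt => /leq_div2r.
Qed.

Lemma few_copies_removal (m n : nat) (tau : 'S_m) (sigma : 'S_n) (L t : nat) :
  (1 < m)%N -> (0 < L)%N -> (num_copies tau sigma < t ^ m)%N ->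
  exists S : {set {set 'I_n}},
    [/\ S \subset index_pairs n,
        (#|S| <= n * L + n * L + n * ((n %/ L).+1 ^ 2 * t))%N &
        destroys_copies S tau sigma].
Proof.
move=> m_gt1 L_gt0 few; set K := (n %/ L).+1.
have ltK (k : 'I_n) : (k %/ L < K)%N by rewrite ltnS leq_div2r // ltnW.
pose cell (x : 'I_n) : 'I_K * 'I_K := (Ordinal (ltK x), Ordinal (ltK (sigma x))).
pose cellmates x := cell @^-1: [set cell x].
pose sameCol (x y : 'I_n) := y %/ L == x %/ L.
pose sameRow (x y : 'I_n) := sigma y %/ L == sigma x %/ L.
(* Testing only the second point suffices: [DD] holds ordered pairs, and both orders give the same
   unordered pair. *)
pose sparse (x y : 'I_n) := (#|cellmates y| < t)%N.
pose D (P : 'I_n -> 'I_n -> bool) := [set p : 'I_n * 'I_n | P p.1 p.2].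
pose DD := D sameCol :|: D sameRow :|: D sparse.
(* The intersection discards the singletons coming from diagonal pairs, which always satisfy
   [sameCol]. *)
exists ([set [set p.1; p.2] | p in DD] :&: index_pairs n); split.
- exact: subsetIr.
- apply: leq_trans (subset_leq_card (subsetIl _ _)) _.
  apply: leq_trans (leq_imset_card _ _) _.
  apply: leq_trans (leq_card_setU _ _) _; apply: leq_add.
    apply: leq_trans (leq_card_setU _ _) _.
    apply: leq_add; rewrite -[X in (_ <= X * _)%N]card_ord.
      by apply: card_pairs_leq => x; exact: card_divn_fiber.
    apply: card_pairs_leq => x.
    (* By injectivity of [sigma], a row has as many points as values, all in one block of length at
       most [L]. *)
    rewrite -(card_imset _ (@perm_inj _ sigma)).
    apply: leq_trans (card_divn_fiber n (sigma x %/ L) L_gt0).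
    apply: subset_leq_card; apply/fintype.subsetP=> _ /imsetP[y + ->].
    by rewrite !inE.
  rewrite -[X in (_ <= X * _)%N]card_ord; apply: card_pairs_leq => x.
  have -> : (K ^ 2 = #|{: 'I_K * 'I_K}|)%N by rewrite card_prod !card_ord.
  exact: card_imset_fiber_lt.
move=> _ /is_copyP[x x_emb ->].
have [incr_x pat_x] := is_embeddingP _ _ _ x_emb.
have x_inj : injective x.
  move=> i j eq_x; have [/incr_x|/incr_x|/val_inj//] := ltngtP i j;
    by rewrite eq_x ltnn.
have [/existsP[i /existsP[j /andP[neq_ij ij_DD]]]|none] :=
    boolP [exists i, exists j, (i != j) && ((x i, x j) \in DD)].
  exists [set x i; x j].
    rewrite !inE cards2 (inj_eq x_inj) neq_ij andbT.
    by apply/imsetP; exists (x i, x j).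
  by apply/fintype.subsetP=> z; rewrite !inE => /orP[]/eqP->; apply: imset_f.
have far i j : i != j ->
    [/\ x i %/ L != x j %/ L, sigma (x i) %/ L != sigma (x j) %/ L &
        t <= #|cellmates (x j)|]%N.
  move=> neq_ij; move: none => /existsPn/(_ i)/existsPn/(_ j).
  rewrite neq_ij /= !inE /sameCol /sameRow /sparse /= !negb_or -leqNgt.
  by move=> /andP[/andP[colN rowN] dense]; rewrite eq_sym colN eq_sym rowN.
suff : (t ^ m <= num_copies tau sigma)%N by rewrite leqNgt few.
apply: leq_trans (leq_embeddings_num_copies tau sigma).
(* [far] speaks of two distinct indices, so a partner for [i] is needed; [m_gt1] supplies it. *)
have dense i : (t <= #|cellmates (x i)|)%N.
  have [j neq_ji] : exists j, j != i.
    have := m_gt1; rewrite -[X in (1 < X)%N]card_ord => /card_gt1P[a [b [_ _ ab]]].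
    by have [<-|] := eqVneq a i; [exists b; rewrite eq_sym | exists a].
  by case: (far j i neq_ji).
(* The members of this family choose one point in each cell met by [x]; there are at least [t ^ m]
   of them, and each is shown to be an embedding. *)
apply: (@leq_trans #|family (fun i => mem (cellmates (x i)))|).
  rewrite card_family foldrE big_map big_enum -[X in (t ^ X)%N]card_ord.
  by rewrite -prod_nat_const; apply: leq_prod => i _; exact: dense.
apply: subset_leq_card; apply/fintype.subsetP=> y /familyP y_fam.
have same i : y i %/ L = x i %/ L /\ sigma (y i) %/ L = sigma (x i) %/ L.
  have := y_fam i; rewrite !inE => /eqP eq_cell.
  split; first by have := congr1 (val \o fst) eq_cell.
  by have := congr1 (val \o snd) eq_cell.
rewrite inE; apply/is_embeddingP; split=> i j.
  move=> lt_ij; have [|colN _ _] := far i j; first by rewrite neq_ltn lt_ij.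
  have := incr_x i j lt_ij; have [yi _] := same i; have [yj _] := same j.
  by rewrite (ltn_divn_neq colN) -yi -yj => lt_y; rewrite (@ltn_divn_neq L) // yi yj.
have [->|neq_ij] := eqVneq i j; first by rewrite !ltnn.
have [_ rowN _] := far i j neq_ij; rewrite -pat_x.
have [_ yi] := same i; have [_ yj] := same j.
by rewrite (ltn_divn_neq rowN) (@ltn_divn_neq L) ?yi ?yj.
Qed.

(** With at most one index, every map is an embedding. Hence [m <= 1] contradicts the assumption of
    o(n ^ m) copies. *)
Lemma num_copies_small_pattern (m n : nat) (tau : 'S_m) (sigma : 'S_n) :
  (m <= 1)%N -> (n ^ m <= num_copies tau sigma)%N.
Proof.
move=> m_le1; apply: leq_trans (leq_embeddings_num_copies tau sigma).
have eq_ord (i j : 'I_m) : i = j.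
  by case: i j => [i lt_im] [j lt_jm]; apply: val_inj => /=; lia.
rewrite -[X in (X ^ _)%N]card_ord -[X in (_ ^ X)%N]card_ord -card_ffun.
apply: subset_leq_card; apply/fintype.subsetP=> x _; rewrite inE.
by apply/is_embeddingP; split=> i j; rewrite (eq_ord i j) !ltnn.
Qed.

(** * Choice of the scales [L] and [t] *)

Lemma leq_double_divn (n d : nat) :
  (0 < d <= n)%N -> (n < 2 * d * (n %/ d))%N.
Proof.
move=> /andP[d_gt0 le_dn]; have := ltn_ceil n d_gt0.
by have : (0 < n %/ d)%N by [rewrite divn_gt0]; nia.
Qed.

Lemma removal (q : nat) : (0 < q)%N ->
  exists N c : nat, (0 < c)%N /\
    forall (m n : nat) (tau : 'S_m) (sigma : 'S_n),
    (1 < m)%N -> (N <= n)%N -> (num_copies tau sigma * c ^ m < n ^ m)%N ->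
    exists S : {set {set 'I_n}},
      [/\ S \subset index_pairs n, (#|S| * q <= n ^ 2)%N &
          destroys_copies S tau sigma].
Proof.
(* With [L] about n / (4q) there are at most 8q blocks per axis. Taking [t] about n / d then makes
   each of the three terms at most n ^ 2 / (4q), for a total below n ^ 2 / q. The 2 in [2 * d] pays
   for rounding [t] down. *)
move=> q_gt0; pose d := (4 * q * (8 * q) ^ 2)%N.
have d_gt0 : (0 < d)%N by rewrite !(muln_gt0, expn_gt0) q_gt0.
have le_qd : (4 * q <= d)%N by rewrite leq_pmulr // expn_gt0 muln_gt0 q_gt0.
exists d, (2 * d)%N; split; first by rewrite muln_gt0.
move=> m n tau sigma m_gt1 le_dn few.
pose L := (n %/ (4 * q))%N; pose t := (n %/ d)%N.
have lt_nL : (n < 8 * q * L)%N.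
  have := @leq_double_divn n (4 * q); rewrite mulnA; apply.
  by rewrite muln_gt0 q_gt0 (leq_trans le_qd).
have lt_nt : (n < 2 * d * t)%N by apply: leq_double_divn; rewrite d_gt0.
have L_gt0 : (0 < L)%N by case: (L) lt_nL => //; rewrite muln0.
have few_t : (num_copies tau sigma < t ^ m)%N.
  have cm_gt0 : (0 < (2 * d) ^ m)%N by rewrite expn_gt0 muln_gt0 d_gt0.
  rewrite -(ltn_pmul2r cm_gt0) -expnMn (leq_trans few) //.
  by rewrite leq_exp2r ?(ltnW m_gt1) // mulnC ltnW.
have [S [sub_S card_S destroy_S]] := few_copies_removal m_gt1 L_gt0 few_t.
exists S; split=> //.
have le_K : ((n %/ L).+1 ^ 2 <= (8 * q) ^ 2)%N by rewrite leq_exp2r // ltn_divLR.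
have le_L : (L * (4 * q) <= n)%N by exact: leq_trunc_div.
have le_t : (t * d <= n)%N by exact: leq_trunc_div.
have {}card_S : (#|S| <= n * L + n * L + n * ((8 * q) ^ 2 * t))%N.
  by apply: leq_trans card_S _; rewrite leq_add2l leq_mul2l leq_mul2r le_K !orbT.
have : (#|S| * (4 * q) <= n * n + n * n + n * n)%N.
  apply: leq_trans (leq_mul card_S (leqnn _)) _.
  have -> : ((n * L + n * L + n * ((8 * q) ^ 2 * t)) * (4 * q) =
    n * (L * (4 * q)) + n * (L * (4 * q)) + n * (t * d))%N by rewrite /d; ring.
  by rewrite !leq_add // leq_mul2l ?le_L ?le_t orbT.
rewrite -mulnn [(4 * q)%N]mulnC mulnA => le3; rewrite -(@leq_pmul2r 4) //.
by apply: (leq_trans le3); rewrite mulnC !mulSn mul0n addn0 !addnA leq_addr.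
Qed.

(** The sets given by [removal] vary with [q], whereas one sequence must serve every epsilon. A
    smallest destroying set inherits all these bounds at once. *)
Lemma minimal_destroying_set (m n : nat) (tau : 'S_m) (sigma : 'S_n) :
  (1 < m)%N -> exists S : {set {set 'I_n}},
    [/\ S \subset index_pairs n, destroys_copies S tau sigma &
        forall S' : {set {set 'I_n}}, S' \subset index_pairs n ->
          destroys_copies S' tau sigma -> (#|S| <= #|S'|)%N].
Proof.
move=> m_gt1; set N := num_copies tau sigma.
(* Blocks of length 1 and threshold [N.+1] give some destroying set to start from; its size is
   irrelevant. *)
have few : (N < N.+1 ^ m)%N.
  by rewrite -[X in (X <= _)%N]expn1 leq_pexp2l // ltnW.
have [S0 [sub_S0 _ destroy_S0]] := few_copies_removal m_gt1 (ltn0Sn 0) few.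
pose good (S : {set {set 'I_n}}) :=
  (S \subset index_pairs n) && `[< destroys_copies S tau sigma >].
have good_S0 : good S0 by rewrite /good sub_S0; exact/asboolP.
case: (arg_minnP (fun S : {set {set 'I_n}} => #|S|) good_S0).
move=> S /andP[sub_S /asboolP destroy_S] min_S; exists S; split=> // S' sub destr.
by apply: min_S; rewrite /good sub; exact/asboolP.
Qed.

(** * Passage to the asymptotic statement *)

Local Open Scope classical_set_scope.
Local Open Scope ring_scope.

Theorem proposition6 (R : realType) (m : nat) (tau : 'S_m)
    (n : nat -> nat) (sigma : forall i : nat, 'S_(n i)) :
  n @ \oo --> \oo ->
  (fun i : nat => (num_copies tau (sigma i))%:R : R)
    =o_\oo (fun i : nat => (n i)%:R ^+ m : R) ->
  exists S : forall i : nat, {set {set 'I_(n i)}},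
    [/\ forall i : nat, S i \subset index_pairs (n i),
        (fun i : nat => #|S i|%:R : R)
          =o_\oo (fun i : nat => (n i)%:R ^+ 2 : R) &
        forall i : nat, destroys_copies (S i) tau (sigma i)].
Proof.
move=> n_oo /eqoP few.
have n_ge (N : nat) : \forall i \near \oo, (N <= n i)%N.
  exact: (n_oo _ (nbhs_infty_ge N)).
have [m_le1|m_gt1] := leqP m 1.
  (* At one large index there would be at most half of n ^ m copies, but there are at least n ^ m >
     0. *)
  have := few 2^-1; rewrite invr_gt0 ltr0n => /(_ isT) few2.
  have [i [ni_gt0]] := @filter_ex _ \oo _ _ (filterI (n_ge 1%N) few2).
  rewrite /= !ger0_norm ?exprn_ge0 ?ler0n //.
  have := num_copies_small_pattern tau (sigma i) m_le1.
  rewrite -(ler_nat R) natrX => le_num le_half.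
  have : 0 < (n i)%:R ^+ m :> R by rewrite exprn_gt0 // ltr0n.
  by lra.
pose ex_min i := minimal_destroying_set tau (sigma i) m_gt1.
exists (fun i => sval (cid (ex_min i))); split.
- by move=> i; case: (svalP (cid (ex_min i))).
- apply/eqoP => eps eps_gt0.
  pose q := (Num.truncn eps^-1).+1.
  have q_eps : q%:R^-1 <= eps.
    rewrite -[leRHS]invrK lef_pV2 ?posrE ?invr_gt0 ?ltr0n //.
    by apply/ltW/truncnS_gt; rewrite ?invr_ge0 ?ltW.
  have [N [c [c_gt0 rem]]] := removal (ltn0Sn (Num.truncn eps^-1)).
  (* Halving turns the non-strict little-o bound into the strict one that [rem] requires. *)
  have cm_gt0 : 0 < (c%:R ^+ m)^-1 / 2 :> R.
    by rewrite divr_gt0 ?invr_gt0 ?exprn_gt0 ?ltr0n.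
  have few_c := few _ cm_gt0.
  near=> i.
  have ni_gt0 : (0 < n i)%N by near: i; exact: n_ge.
  have N_le : (N <= n i)%N by near: i; exact: n_ge.
  have few_i : (num_copies tau (sigma i))%:R <=
      (c%:R ^+ m)^-1 / 2 * (n i)%:R ^+ m :> R.
    have : `|(num_copies tau (sigma i))%:R : R| <=
      (c%:R ^+ m)^-1 / 2 * `|(n i)%:R ^+ m : R| by near: i.
    by rewrite !ger0_norm ?exprn_ge0 ?ler0n.
  have lt_i : (num_copies tau (sigma i) * c ^ m < n i ^ m)%N.
    rewrite -(ltr_nat R) natrM !natrX -ltr_pdivlMr ?exprn_gt0 ?ltr0n //.
    apply: le_lt_trans few_i _; rewrite mulrC mulrA.
    have : 0 < (n i)%:R ^+ m * (c%:R ^+ m)^-1 :> R.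
      by rewrite divr_gt0 ?exprn_gt0 ?ltr0n.
    by lra.
  have [S [sub_S card_S destroy_S]] := rem _ _ _ _ m_gt1 N_le lt_i.
  (* Minimality carries the bound on the epsilon-dependent [S] over to the chosen set. *)
  have [_ _ /(_ S sub_S destroy_S) le_S] := svalP (cid (ex_min i)).
  rewrite !ger0_norm ?exprn_ge0 ?ler0n //.
  apply: (@le_trans _ _ (q%:R^-1 * (n i)%:R ^+ 2)); last first.
    by rewrite ler_wpM2r // exprn_ge0 // ler0n.
  rewrite ler_pdivlMl ?ltr0n // -natrX -natrM ler_nat mulnC.
  by apply: leq_trans card_S; rewrite leq_mul2r le_S orbT.
- by move=> i; case: (svalP (cid (ex_min i))).
Unshelve. all: by end_near.
Qed.
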